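(* Let $m,n\ge 1$, let $0<\mu_1<\dots<\mu_m$ and $0<\lambda_1\le\dots\le\lambda_n$ be real constants, and let $\Sigma^{++}=(\sigma^{++}_{ij})\in\mathbb{R}^{n\times n}$, $\Sigma^{+-}=(\sigma^{+-}_{ij})\in\mathbb{R}^{n\times m}$, $\Sigma^{-+}=(\sigma^{-+}_{ij})\in\mathbb{R}^{m\times n}$, $\Sigma^{--}=(\sigma^{--}_{ij})\in\mathbb{R}^{m\times m}$, $Q_0=(q_{ij})\in\mathbb{R}^{n\times m}$ be constant matrices. Let $\mathcal{T}=\{(x,\xi)\in[0,1]^2:\ \xi\le x\}$. Consider the following system for the unknown kernels $K=(K_{ij})_{1\le i\le m,1\le j\le n}$ and $L=(L_{ij})_{1\le i,j\le m}$ on $\mathcal{T}$. For $1\le i\le m$, $1\le j\le n$: $$\mu_i\partial_xK_{ij}(x,\xi)-\lambda_j\partial_\xi K_{ij}(x,\xi)=\sum_{k=1}^n\sigma^{++}_{kj}K_{ik}(x,\xi)+\sum_{p=1}^m\sigma^{-+}_{pj}L_{ip}(x,\xi)-\sum_{i\le p\le m}K_{pj}(x,\xi)\,\omega_{ip}(x).$$ For $1\le i,j\le m$: $$\mu_i\partial_xL_{ij}(x,\xi)+\mu_j\partial_\xi L_{ij}(x,\xi)=\sum_{k=1}^m\sigma^{--}_{kj}L_{ik}(x,\xi)+\sum_{p=1}^n\sigma^{+-}_{pj}K_{ip}(x,\xi)-\sum_{i\le p\le m}L_{pj}(x,\xi)\,\omega_{ip}(x).$$ Boundary conditions: $$K_{ij}(x,x)=-\frac{\sigma^{-+}_{ij}}{\mu_i+\lambda_j}\quad(1\le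 i\le m,\ 1\le j\le n),$$ $$L_{ij}(x,x)=-\frac{\sigma^{--}_{ij}}{\mu_i-\mu_j}\quad(1\le j<i\le m),$$ $$\mu_jL_{ij}(x,0)=\sum_{k=1}^n\lambda_kK_{ik}(x,0)q_{kj}\quad(1\le i,j\le m).$$ Here the coefficients $\omega_{ij}$ are themselves determined by $L$ through $$\omega_{ij}(x)=(\mu_i-\mu_j)L_{ij}(x,x)+\sigma^{--}_{ij}\qquad(1\le i\le j\le m).$$ Then this system has a unique solution $(K,L)$ in $L^\infty(\mathcal{T})$.
   Context: Solutions are understood in the integrated sense along characteristics: $K,L$ are bounded functions on $\mathcal{T}$ satisfying, for every $(x,\xi)\in\mathcal{T}$, the following integral equations. For $K_{ij}$: from $(x,\xi)$ follow the line $s\mapsto(x-\mu_is,\ \xi+\lambda_js)$ until it reaches the diagonal $\{x=\xi\}$, at time $s^F_{ij}=(x-\xi)/(\mu_i+\lambda_j)$. Then $K_{ij}(x,\xi)$ equals $-\sigma^{-+}_{ij}/(\mu_i+\lambda_j)$ plus the integral over $s\in[0,s^F_{ij}]$ of the right-hand side of the $K_{ij}$-equation evaluated along this line. For $L_{ij}$: from $(x,\xi)$ follow the line $\nu\mapsto(x-\mu_i\nu,\ \xi-\mu_j\nu)$ until it reaches the boundary of $\mathcal{T}$, at time $\nu^F_{ij}$. If $j<i$ and $\mu_i\xi-\mu_jx\ge0$, the line terminates on the diagonal and the terminal value is $-\sigma^{--}_{ij}/(\mu_i-\mu_j)$. Otherwise it terminates at a point $(\chi^F,0)$ and the terminal value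 is $\frac1{\mu_j}\sum_{k=1}^n\lambda_kq_{kj}K_{ik}(\chi^F,0)$. Then $L_{ij}(x,\xi)$ equals the terminal value plus the integral over $\nu\in[0,\nu^F_{ij}]$ of the right-hand side of the $L_{ij}$-equation evaluated along this line. In these integrals $\omega_{ip}(x)$ stands for $(\mu_i-\mu_p)L_{ip}(x,x)+\sigma^{--}_{ip}$. *)

(* Defs.v *)
(* MathComp / MathComp-Analysis *)
From HB Require Import structures.
From mathcomp Require Import all_boot all_order all_algebra.
From mathcomp Require Import all_classical all_reals all_analysis.
Set Implicit Arguments.
Unset Strict Implicit.
Unset Printing Implicit Defensive.
Import Order.TTheory GRing.Theory Num.Theory.
Import numFieldNormedType.Exports.
Local Open Scope classical_set_scope.
Local Open Scope ring_scope.

Definition triangle (R : realType) : set (R * R) :=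
  [set z | [/\ 0 <= z.1 <= 1, 0 <= z.2 <= 1 & z.2 <= z.1]].
Arguments triangle : clear implicits.

(* A matrix-valued kernel is a total function on R * R; only its values on the
   triangle are ever constrained. *)
Definition bounded_kernel (R : realType) (a b : nat)
    (F : R * R -> 'M[R]_(a, b)) : Prop :=
  exists M : R, forall z i j, triangle R z -> `|F z i j| <= M.

(* Everywhere-defined representatives: Borel measurable and bounded on the
   triangle at every point, not merely almost everywhere. *)
Definition Linfty_kernel (R : realType) (a b : nat)
    (F : R * R -> 'M[R]_(a, b)) : Prop :=
  bounded_kernel F /\
  forall i j, measurable_fun (triangle R) (fun z => F z i j).

Definition agree_on_triangle (R : realType) (a b : nat)
    (F G : R * R -> 'M[R]_(a, b)) : Prop :=
  forall z, triangle R z -> F z = G z.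

(* v = c + \int_0^t f, the integral being required to exist: [Rintegral] alone
   would return a default value for a non-integrable f. *)
Definition eq_plus_integral (R : realType) (v c t : R) (f : R -> R) : Prop :=
  (@lebesgue_measure R).-integrable `[0, t] (EFin \o f) /\
  v = c + \int[@lebesgue_measure R]_(s in `[0, t]) f s.

Section KernelSystem.
Variables (R : realType) (m n : nat).
Variables (mu : 'I_m -> R) (lambda : 'I_n -> R).
Variables (Spp : 'M[R]_n) (Spm : 'M[R]_(n, m)).
Variables (Smp : 'M[R]_(m, n)) (Smm : 'M[R]_m).
Variable (Q0 : 'M[R]_(n, m)).
Variables (K : R * R -> 'M[R]_(m, n)) (L : R * R -> 'M[R]_m).

Definition omega (i p : 'I_m) (x : R) : R :=
  (mu i - mu p) * L (x, x) i p + Smm i p.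

Definition rhsK (i : 'I_m) (j : 'I_n) (z : R * R) : R :=
  \sum_(k < n) Spp k j * K z i k + \sum_(p < m) Smp p j * L z i p
  - \sum_(p < m | (i <= p)%N) K z p j * omega i p z.1.

Definition rhsL (i j : 'I_m) (z : R * R) : R :=
  \sum_(k < m) Smm k j * L z i k + \sum_(p < n) Spm p j * K z i p
  - \sum_(p < m | (i <= p)%N) L z p j * omega i p z.1.

Definition lineK (i : 'I_m) (j : 'I_n) (z : R * R) (s : R) : R * R :=
  (z.1 - mu i * s, z.2 + lambda j * s).

Definition timeK (i : 'I_m) (j : 'I_n) (z : R * R) : R :=
  (z.1 - z.2) / (mu i + lambda j).

Definition lineL (i j : 'I_m) (z : R * R) (s : R) : R * R :=
  (z.1 - mu i * s, z.2 - mu j * s).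

Definition ends_on_diagonal (i j : 'I_m) (z : R * R) : bool :=
  (j < i)%N && (0 <= mu i * z.2 - mu j * z.1).

(* First branch: time at which the two coordinates of [lineL] coincide;
   second branch: time at which its second coordinate vanishes. *)
Definition timeL (i j : 'I_m) (z : R * R) : R :=
  if ends_on_diagonal i j z then (z.1 - z.2) / (mu i - mu j)
  else z.2 / mu j.

Definition terminalK (i : 'I_m) (j : 'I_n) : R :=
  - (Smp i j / (mu i + lambda j)).

Definition terminalL (i j : 'I_m) (z : R * R) : R :=
  if ends_on_diagonal i j z then - (Smm i j / (mu i - mu j))
  else (mu j)^-1 * \sum_(k < n) lambda k * Q0 k j *
         K ((lineL i j z (timeL i j z)).1, 0) i k.

(* Bounded solutions of the kernel equations integrated along characteristics.
   The boundary conditions are built in: at points where a characteristic has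
   length 0 the equations reduce to the terminal values. *)
Definition is_solution : Prop :=
  [/\ bounded_kernel K,
      bounded_kernel L,
      forall z i j, triangle R z ->
        eq_plus_integral (K z i j) (terminalK i j) (timeK i j z)
          (fun s => rhsK i j (lineK i j z s))
    & forall z i j, triangle R z ->
        eq_plus_integral (L z i j) (terminalL i j z) (timeL i j z)
          (fun s => rhsL i j (lineL i j z s))].

End KernelSystem.

(* Main.v *)
Require Import Defs.
From HB Require Import structures.
From mathcomp Require Import all_boot all_order all_algebra.
From mathcomp Require Import all_classical all_reals all_analysis.
From mathcomp Require Import measurable_realfun ring lra.
Set Implicit Arguments.
Unset Strict Implicit.
Unset Printing Implicit Defensive.
Import Order.TTheory GRing.Theory Num.Theory.
Import numFieldNormedType.Exports.
Local Open Scope classical_set_scope.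
Local Open Scope ring_scope.

(* Since omega_ii = sigma_ii is a constant and omega_ip only involves row i of
   L, the equations of row i are affine in row i once the rows p > i are known,
   so the rows are solved one at a time from the last one up.  Every
   characteristic of row i moves in x at speed mu_i, whence a Volterra structure
   in x: in the norm weighting K by a e^(alpha x) and L by e^(alpha x), the
   integral terms have Lipschitz constant O(1/alpha).  The boundary condition on
   xi = 0 is not integrated, but it reads L off K, so a small a makes it
   contracting as well.  The same estimate gives existence, by Picard iteration on
   bounded measurable kernels, and uniqueness among merely bounded ones. *)

(** * Fixed points of contractions in a weighted sup norm *)

Lemma eq0_of_halving (R : realType) (x C : R) :
  (forall k, `|x| <= C / 2 ^+ k) -> x = 0.
Proof.
move=> xC; apply/normr0_eq0/le_anti; rewrite normr_ge0 andbT.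
have gC : @geometric R C 2^-1 @ \oo --> 0.
  by apply: cvg_geometric; rewrite ger0_norm ?invr_ge0// invf_lt1// ltr1n.
rewrite -(cvg_lim _ gC)//; apply: limr_ge; first by apply: cvgP gC.
by near=> k; rewrite /geometric /= exprVn.
Unshelve. all: by end_near. Qed.

(* Picard iteration from 0.  The weight may vanish; the fixed point is then 0 there. *)
Lemma weighted_fixed_point (R : realType) (X : Type) (E : set (X -> R))
    (w : X -> R) (Phi : (X -> R) -> X -> R) (C : R) :
  (forall x, 0 <= w x) -> 0 <= C ->
  E (fun=> 0) -> (forall u, E u -> E (Phi u)) ->
  (forall (u : nat -> X -> R) v, (forall k, E (u k)) ->
     (forall x, u^~ x @ \oo --> v x) -> (forall x, `|v x| <= C * w x) -> E v) ->
  (forall u v c, E u -> E v -> 0 <= c ->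
     (forall x, `|u x - v x| <= c * w x) ->
     forall x, `|Phi u x - Phi v x| <= c / 2 * w x) ->
  (forall x, `|Phi (fun=> 0) x| <= C / 2 * w x) ->
  exists2 u, E u & forall x, Phi u x = u x.
Proof.
move=> w0 C0 E0 EPhi Ecl Phic Phi0.
pose u k := iter k Phi (fun=> 0).
have Eu k : E (u k) by elim: k => //= k; exact: EPhi.
(* The bound reproduces itself: half of [C * w] covers [Phi 0], and the contraction, applied to
   [u p] and 0, contributes the other half. *)
have uC p x : `|u p x| <= C * w x.
  elim: p x => [|p IH] x; first by rewrite normr0 mulr_ge0.
  have dPhi : `|Phi (u p) x - Phi (fun=> 0) x| <= C / 2 * w x.
    by apply: Phic => // y; rewrite subr0.
  rewrite -(subrK (Phi (fun=> 0) x) (u p.+1 x)) (le_trans (ler_normD _ _))//.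
  by have := lerD dPhi (Phi0 x); rewrite -mulrDl -splitr.
have ud k p x : `|u (k + p)%N x - u k x| <= C / 2 ^+ k * w x.
  elim: k x => [|k IH] x; first by rewrite add0n subr0 expr0 divr1.
  rewrite addSn exprSr invfM mulrA; apply: Phic => //.
  by rewrite divr_ge0// exprn_ge0.
have ucvg x : cvgn (u^~ x).
  apply/cauchy_cvgP/cauchy_exP => e e0.
  have gC : @geometric R (C * w x) 2^-1 @ \oo --> 0.
    by apply: cvg_geometric; rewrite ger0_norm ?invr_ge0// invf_lt1// ltr1n.
  have [N _ NP] : \forall k \near \oo, `|0 - @geometric R (C * w x) 2^-1 k| < e.
    exact: (cvgr_dist_lt _ _ gC).
  exists (u N x); exists N => //= k /= Nk.
  rewrite -ball_normE /= distrC -(subnKC Nk) (le_lt_trans (ud _ _ _))//.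
  have := NP N (leqnn N); rewrite sub0r normrN /geometric/= => NN.
  apply: le_lt_trans NN; rewrite exprVn mulrAC.
  exact: ler_norm.
pose v x := limn (u^~ x).
have uv x : u^~ x @ \oo --> v x by exact: ucvg.
have lim_le x (a B : R) k : (forall p, `|u (k + p)%N x - a| <= B) -> `|v x - a| <= B.
  move=> uB; have cv : `|u n x - a| @[n --> \oo] --> `|v x - a|.
    by apply: cvg_norm; apply: cvgB; [exact: uv|exact: cvg_cst].
  rewrite -(cvg_lim _ cv)//; apply: limr_le; first exact: cvgP cv.
  by exists k => // p /= kp; rewrite -(subnKC kp).
have vC x : `|v x| <= C * w x.
  by rewrite -[v x]subr0; apply: (@lim_le _ _ _ 0) => p; rewrite subr0.
have Ev : E v by exact: (Ecl u).
exists v => // x.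
have vd k y : `|v y - u k y| <= C / 2 ^+ k * w y.
  by apply: (lim_le _ _ _ k) => p; exact: ud.
(* [Phi v] and [v] are each within [C / 2 ^+ k.+1 * w] of [u k.+1], hence within [C / 2 ^+ k * w] of
   each other, for every [k]. *)
apply/eqP; rewrite -subr_eq0; apply/eqP.
apply: (@eq0_of_halving _ _ (C * w x)) => k.
have h : `|Phi v x - u k.+1 x| <= C / 2 ^+ k / 2 * w x.
  by apply: Phic => //; rewrite divr_ge0// exprn_ge0.
have := lerD h (vd k.+1 x); rewrite [`|v x - _|]distrC => /(le_trans (ler_normD _ _)).
rewrite addrA subrK => /le_trans; apply.
by rewrite exprSr invfM mulrA -mulrDl -splitr mulrAC.
Qed.

(** * Integrals along characteristics: decay and measurability in the starting point *)

(** The integrand is dominated by a constant times the density of the exponential law of rate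
    [alpha * mu]. That density has total mass 1, so the bound does not depend on [t] and gains the
    factor [1 / alpha]. *)
Lemma Rintegral_exp_decay (R : realType) (f g : R -> R) (B alpha mu x t : R) :
  0 <= B -> 0 < alpha -> 0 < mu ->
  (@lebesgue_measure R).-integrable `[0, t] (EFin \o f) ->
  (@lebesgue_measure R).-integrable `[0, t] (EFin \o g) ->
  (forall s, 0 <= s <= t -> `|f s - g s| <= B * expR (alpha * (x - mu * s))) ->
  `|\int[@lebesgue_measure R]_(s in `[0, t]) f s
    - \int[@lebesgue_measure R]_(s in `[0, t]) g s|
    <= B / (alpha * mu) * expR (alpha * x).
Proof.
move=> B0 a0 m0 fi gi fg.
have mt : measurable (`[0, t] : set (measurableTypeR R)) by exact: measurable_itv.
have am0 : 0 < alpha * mu by rewrite mulr_gt0.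
set D := B / (alpha * mu) * expR (alpha * x).
have D0 : 0 <= D by rewrite mulr_ge0 ?expR_ge0// divr_ge0// ltW.
have pi0 := integrable_exponential_pdf am0.
have pit : (@lebesgue_measure R).-integrable `[0, t]
    (EFin \o exponential_pdf (alpha * mu)).
  by apply: integrableS pi0 => //.
have pDi : (@lebesgue_measure R).-integrable `[0, t]
    (EFin \o (fun s => D * exponential_pdf (alpha * mu) s)).
  by have := integrableZl mt D pit; apply: eq_integrable.
have fgi : (@lebesgue_measure R).-integrable `[0, t] (EFin \o (fun s => f s - g s)).
  by have := integrableB mt fi gi; apply: eq_integrable.
rewrite -RintegralB//; apply: le_trans (le_normr_Rintegral _ _) _ => //.
apply: (@le_trans _ _ (\int[@lebesgue_measure R]_(s in `[0, t])
    (D * exponential_pdf (alpha * mu) s))).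
  apply: le_Rintegral => //.
    by have := integrable_abse fgi; apply: eq_integrable.
  move=> s /=; rewrite in_itv/= => /[dup] st /andP[s0 _].
  rewrite exponential_pdfE//; apply: le_trans (fg _ st) _.
  rewrite (_ : alpha * (x - mu * s) = alpha * x + - (alpha * mu) * s); last by ring.
  rewrite expRD le_eqVlt; apply/orP; left; apply/eqP.
  by rewrite /D; field; rewrite !gt_eqF.
rewrite RintegralZl// -[leRHS]mulr1 ler_wpM2l//.
rewrite /Rintegral -[leRHS]/(fine 1%E) fine_le//.
  exact: integrable_fin_num.
rewrite -(integral_exponential_pdf am0); apply: ge0_subset_integral => //.
  by apply/measurable_EFinP; exact: measurable_exponential_pdf.
by move=> s _; rewrite lee_fin exponential_pdf_ge0// ltW.
Qed.

(** Tonelli's theorem covers nonnegative integrands, so the positive and negative parts are treated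
    separately. *)
Lemma measurable_fun_partial_integral (R : realType) d1 d2
    (T1 : measurableType d1) (T2 : measurableType d2)
    (mu : {sigma_finite_measure set T2 -> \bar R}) (f : T1 * T2 -> \bar R) :
  measurable_fun setT f ->
  measurable_fun setT (fun x => \int[mu]_y f (x, y))%E.
Proof.
move=> mf; under eq_fun do rewrite integralE.
apply: emeasurable_funB.
  have := @measurable_fun_fubini_tonelli_F _ _ _ _ _ mu (f^\+)%E
    (measurable_funepos mf) (funepos_ge0 f).
  by rewrite /fubini_F !funepos.unlock.
have := @measurable_fun_fubini_tonelli_F _ _ _ _ _ mu (f^\-)%E
  (measurable_funeneg mf) (funeneg_ge0 f).
by rewrite /fubini_F !funeneg.unlock.
Qed.

(** The moving endpoint is absorbed into the integrand: cutting [f] off outside [[0, t z]] leaves an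
    integral over the whole line, with a jointly measurable integrand. *)
Lemma measurable_fun_Rintegral_itv (R : realType) d (T : measurableType d)
    (t : T -> R) (f : T * R -> R) :
  measurable_fun setT t -> measurable_fun setT f ->
  measurable_fun setT (fun z => \int[@lebesgue_measure R]_(s in `[0, t z]) f (z, s)).
Proof.
move=> mt mf; rewrite /Rintegral.
apply: (measurableT_comp (@fine_measurable R _ measurableT)) => //=.
pose g (p : T * R) : \bar R := (if (0 <= p.2) && (p.2 <= t p.1) then f p else 0)%:E.
rewrite (_ : (fun z => _) = (fun z => \int[@lebesgue_measure R]_s g (z, s))%E).
  apply: measurable_fun_partial_integral.
  apply/measurable_EFinP; apply: measurable_fun_ifT => //.
  apply: measurable_and; apply: measurable_fun_ler => //.
  exact: measurableT_comp.
apply/funext => z; rewrite integral_mkcond; apply: eq_integral => s _.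
by rewrite patchE /g mem_setE in_itv/=; case: ifP.
Qed.

(** * Bounded measurable functions *)

(** Both conditions are global, so composing with a characteristic raises no question of where that
    characteristic leaves the triangle. *)
Definition bounded_measurable (R : realType) d (T : measurableType d) (f : T -> R) :=
  measurable_fun setT f /\ exists B, forall x, `|f x| <= B.

Section BoundedMeasurable.
Variables (R : realType) (d : measure_display) (T : measurableType d).
Implicit Types f g : T -> R.

Lemma bounded_measurable_cst (c : R) : bounded_measurable (fun _ : T => c).
Proof. by split; [exact: measurable_cst|exists `|c|]. Qed.

Lemma bounded_measurableD f g : bounded_measurable f -> bounded_measurable g ->
  bounded_measurable (fun x => f x + g x).
Proof.
move=> [mf [A fA]] [mg [B gB]]; split; first exact: measurable_funD.
by exists (A + B) => x; rewrite (le_trans (ler_normD _ _))// lerD.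
Qed.

Lemma bounded_measurableM f g : bounded_measurable f -> bounded_measurable g ->
  bounded_measurable (fun x => f x * g x).
Proof.
move=> [mf [A fA]] [mg [B gB]]; split; first exact: measurable_funM.
by exists (A * B) => x; rewrite normrM ler_pM.
Qed.

Lemma bounded_measurableB f g : bounded_measurable f -> bounded_measurable g ->
  bounded_measurable (fun x => f x - g x).
Proof.
move=> [mf [A fA]] [mg [B gB]]; split; first exact: measurable_funB.
by exists (A + B) => x; rewrite (le_trans (ler_normB _ _))// lerD.
Qed.

Lemma bounded_measurable_sum (I : Type) (r : seq I) (P : pred I) (h : I -> T -> R) :
  (forall i, bounded_measurable (h i)) ->
  bounded_measurable (fun x => \sum_(i <- r | P i) h i x).
Proof.
move=> bh; elim: r => [|i r IH].
  by under eq_fun do rewrite big_nil; exact: bounded_measurable_cst.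
under eq_fun do rewrite big_cons.
by case: (P i) => //; exact: bounded_measurableD.
Qed.

Lemma bounded_measurable_comp d' (T' : measurableType d') f (h : T' -> T) :
  bounded_measurable f -> measurable_fun setT h ->
  bounded_measurable (fun x => f (h x)).
Proof.
move=> [mf [A fA]] mh; split; last by exists A.
exact: (measurableT_comp mf mh).
Qed.

End BoundedMeasurable.

Lemma bounded_measurable_integrable (R : realType) (f : R -> R) (t : R) :
  bounded_measurable f ->
  (@lebesgue_measure R).-integrable `[0, t] (EFin \o f).
Proof.
move=> [mf [B fB]].
have mt : measurable (`[0, t] : set (measurableTypeR R)) by exact: measurable_itv.
have ft : (@lebesgue_measure R `[0%R, t]%classic < +oo)%E.
  by rewrite lebesgue_measure_itv/=; case: ifP => // _; rewrite -EFinB ltry.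
apply: measurable_bounded_integrable => //.
- exact: measurable_funTS mf.
- exists B; split; first exact: num_real.
  by move=> M BM x _; apply: le_trans (fB x) (ltW BM).
Qed.

Lemma finite_ub (R : realType) (I : finType) (f : I -> R) :
  exists2 C, 0 <= C & forall i, f i <= C.
Proof.
exists (\sum_i `|f i|); first exact: sumr_ge0.
move=> i; rewrite (bigD1 i)//= (le_trans (ler_norm _))// lerDl.
exact: sumr_ge0.
Qed.

Section Rows.
Variables (R : realType) (m n : nat).
Variables (mu : 'I_m -> R) (lambda : 'I_n -> R).
Variables (Spp : 'M[R]_n) (Spm : 'M[R]_(n, m)).
Variables (Smp : 'M[R]_(m, n)) (Smm : 'M[R]_m) (Q0 : 'M[R]_(n, m)).
Hypothesis mu_gt0 : forall i, 0 < mu i.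
Hypothesis mu_incr : forall i j : 'I_m, (i < j)%N -> mu i < mu j.
Hypothesis lambda_gt0 : forall j, 0 < lambda j.

Local Notation rhsK := (rhsK mu Spp Smp Smm).
Local Notation rhsL := (rhsL mu Spm Smm).
Local Notation lineK := (lineK mu lambda).
Local Notation timeK := (timeK mu lambda).
Local Notation lineL := (lineL mu).
Local Notation timeL := (timeL mu).
Local Notation terminalK := (terminalK mu lambda Smp).
Local Notation terminalL := (terminalL mu lambda Smm Q0).
Implicit Types (K : R * R -> 'M[R]_(m, n)) (L : R * R -> 'M[R]_m).

(** * Geometry of the characteristics *)

Lemma lineK_triangle i j z s : triangle R z -> 0 <= s <= timeK i j z ->
  triangle R (lineK i j z s).
Proof.
case: z => x y [/= /andP[x0 x1] /andP[y0 y1] yx] /andP[s0 st].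
have mi := mu_gt0 i; have lj := lambda_gt0 j.
have := st; rewrite /timeK ler_pdivlMr ?addr_gt0//= => {}st.
rewrite /triangle/=; have a := mulr_ge0 (ltW mi) s0; have b := mulr_ge0 (ltW lj) s0.
by split; [apply/andP; split| apply/andP; split|]; lra.
Qed.

Lemma timeL_ge0 i j z : triangle R z -> 0 <= timeL i j z.
Proof.
case: z => x y [/= /andP[x0 x1] /andP[y0 y1] yx]; rewrite /timeL.
case: ifP => [/andP[ji _]|_] /=; apply: divr_ge0 => //=.
- by rewrite subr_ge0.
- by rewrite subr_ge0 ltW// mu_incr.
- exact: ltW.
Qed.

(** For [j < i] the line meets either the diagonal or the axis first, and the sign of
    [mu i * z.2 - mu j * z.1] decides which. Multiplying the remaining constraint by [mu i - mu j]
    or by [mu j] reduces it to that sign. For [i <= j] the gap between the coordinates never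
    shrinks. *)
Lemma lineL_triangle i j z s : triangle R z -> 0 <= s <= timeL i j z ->
  triangle R (lineL i j z s).
Proof.
case: z => x y [/= /andP[x0 x1] /andP[y0 y1] yx] /andP[s0].
have mi := mu_gt0 i; have mj := mu_gt0 j.
have a := mulr_ge0 (ltW mi) s0; have b := mulr_ge0 (ltW mj) s0.
rewrite /timeL /ends_on_diagonal /triangle/=.
case: (ltnP j i) => [ji|ij] /=.
  have mji := mu_incr ji.
  case: ifPn => [d|]; last (rewrite -ltNge => d); rewrite ler_pdivlMr ?subr_gt0// => st.
    have h : s * (mu i - mu j) * mu j <= (x - y) * mu j by rewrite ler_pM2r.
    have : 0 <= (y - mu j * s) * (mu i - mu j) by lra.
    rewrite pmulr_lge0 ?subr_gt0// => h'.
    by split; [apply/andP; split| apply/andP; split|]; lra.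
  have h : s * mu j * (mu i - mu j) <= y * (mu i - mu j) by rewrite ler_pM2r ?subr_gt0.
  have : 0 <= (x - y - (mu i - mu j) * s) * mu j by lra.
  rewrite pmulr_lge0// => h'.
  by split; [apply/andP; split| apply/andP; split|]; lra.
rewrite ler_pdivlMr// => st.
have mij : mu i <= mu j.
  by move: ij; rewrite leq_eqVlt => /orP[/eqP/val_inj->|/mu_incr/ltW].
have : mu i * s <= mu j * s by rewrite ler_wpM2r.
by move=> h; split; [apply/andP; split| apply/andP; split|]; lra.
Qed.

(** Off the diagonal case, [timeL] is the time at which the second coordinate vanishes, so the point
    is the end of the characteristic itself. *)
Lemma terminal_point_triangle i j z : triangle R z -> ~~ ends_on_diagonal mu i j z ->
  triangle R ((lineL i j z (timeL i j z)).1, 0).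
Proof.
move=> Tz nd; have t0 := timeL_ge0 i j Tz.
rewrite (_ : (_, 0) = lineL i j z (timeL i j z)).
  by apply: lineL_triangle => //; rewrite t0 lexx.
congr (_, _); rewrite /timeL (negbTE nd) mulrC divfK ?subrr//.
by rewrite gt_eqF.
Qed.

(** * Reaction terms and their Lipschitz estimate *)

(** The two right-hand sides have the same shape once [K] and [L] swap roles, so one estimate serves
    both. The coefficients [w] are kept as a parameter, standing for [omega]. *)
Definition reaction a b (A : 'M[R]_a) (B : 'M[R]_(b, a)) (X : 'M[R]_(m, a))
    (Y : 'M[R]_(m, b)) (w : 'I_m -> R) (i : 'I_m) (j : 'I_a) : R :=
  \sum_(k < a) A k j * X i k + \sum_(p < b) B p j * Y i p
  - \sum_(p < m | (i <= p)%N) X p j * w p.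

Lemma rhsK_reaction K L i j z :
  rhsK K L i j z = reaction Spp Smp (K z) (L z) (fun p => omega mu Smm L i p z.1) i j.
Proof. by []. Qed.

Lemma rhsL_reaction K L i j z :
  rhsL K L i j z = reaction Smm Spm (L z) (K z) (fun p => omega mu Smm L i p z.1) i j.
Proof. by []. Qed.

Definition reaction_lipschitz a b (A : 'M[R]_a) (B : 'M[R]_(b, a)) (M : R) (i : 'I_m)
    (j : 'I_a) : R :=
  \sum_(k < a) `|A k j| + \sum_(p < b) `|B p j|
  + \sum_(p < m) (`|Smm i p| + M * `|mu i - mu p|).

(* Once the rows p > i are shared, the quadratic term is affine in row i,
   because omega_ii does not depend on the kernels. *)
Lemma reaction_dist a b (A : 'M[R]_a) (B : 'M[R]_(b, a)) (X X' : 'M[R]_(m, a))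
    (Y Y' : 'M[R]_(m, b)) (w w' : 'I_m -> R) (M D : R) (i : 'I_m) (j : 'I_a) :
  0 <= M -> 0 <= D ->
  (forall (p : 'I_m) k, (i < p)%N -> X p k = X' p k /\ `|X p k| <= M) ->
  (forall k, `|X i k - X' i k| <= D) -> (forall k, `|Y i k - Y' i k| <= D) ->
  w i = Smm i i -> w' i = Smm i i ->
  (forall p, `|w p - w' p| <= `|mu i - mu p| * D) ->
  `|reaction A B X Y w i j - reaction A B X' Y' w' i j|
    <= reaction_lipschitz A B M i j * D.
Proof.
move=> M0 D0 XM dX dY wi w'i dw; rewrite /reaction.
have E (a1 a2 a3 b1 b2 b3 : R) : a1 + a2 - a3 - (b1 + b2 - b3)
  = (a1 - b1) + (a2 - b2) - (a3 - b3) by ring.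
rewrite E -!sumrB /reaction_lipschitz !mulrDl !mulr_suml.
rewrite (le_trans (ler_normB _ _))// lerD//.
  rewrite (le_trans (ler_normD _ _))// lerD// (le_trans (ler_norm_sum _ _ _))//;
    by apply: ler_sum => k _; rewrite -mulrBr normrM ler_wpM2l.
rewrite (le_trans (ler_norm_sum _ _ _))// big_mkcond/=; apply: ler_sum => p _.
have pos1 : 0 <= `|Smm i p| * D by rewrite mulr_ge0.
have pos2 : 0 <= M * `|mu i - mu p| * D by rewrite !mulr_ge0.
rewrite mulrDl; case: ifP => [|_]; last exact: addr_ge0.
(* For [p = i] the coefficients agree and the kernels differ; for [p > i] the kernels agree and the
   coefficients differ. *)
rewrite leq_eqVlt => /orP[/eqP/val_inj ip|ip].
  rewrite -ip wi w'i in pos2 *; rewrite -mulrBl normrM mulrC.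
  by apply: le_trans (_ : _ <= `|Smm i i| * D) _; [exact: ler_wpM2l|rewrite lerDl].
have [<- XpM] := XM p j ip.
rewrite -mulrBr normrM; apply: le_trans (_ : _ <= M * `|mu i - mu p| * D) _.
  by rewrite -mulrA ler_pM.
by rewrite lerDr.
Qed.

(** * The update operator and its contraction on one row *)

Definition updateK K L i j z : R :=
  terminalK i j
  + \int[@lebesgue_measure R]_(s in `[0, timeK i j z]) rhsK K L i j (lineK i j z s).

Definition updateL K L i j z : R :=
  terminalL K i j z
  + \int[@lebesgue_measure R]_(s in `[0, timeL i j z]) rhsL K L i j (lineL i j z s).

(** Stated separately from measurability, because the contraction is also applied to solutions that
    are only known to be bounded. *)
Definition row_integrable K L i z : Prop :=
  (forall j, (@lebesgue_measure R).-integrable `[0, timeK i j z]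
     (EFin \o (fun s => rhsK K L i j (lineK i j z s)))) /\
  (forall j, (@lebesgue_measure R).-integrable `[0, timeL i j z]
     (EFin \o (fun s => rhsL K L i j (lineL i j z s)))).

Definition rows_shared K L K' L' M (i : 'I_m) : Prop :=
  forall z (p : 'I_m), triangle R z -> (i < p)%N ->
    (forall j, K z p j = K' z p j /\ `|K z p j| <= M) /\
    (forall j, L z p j = L' z p j /\ `|L z p j| <= M).

(* The weight a on K absorbs the boundary condition on \xi = 0, which feeds K
   into L without any integration. *)
Definition row_close (alpha a c : R) (k k' : R * R -> 'I_n -> R)
    (l l' : R * R -> 'I_m -> R) : Prop :=
  forall z, triangle R z ->
    (forall j, `|k z j - k' z j| <= c * (a * expR (alpha * z.1))) /\
    (forall j, `|l z j - l' z j| <= c * expR (alpha * z.1)).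

(** The parameters depend on the data and on [M] alone, not on the kernels compared, so the estimate
    can be iterated. *)
Lemma row_contraction i M : 0 <= M -> exists alpha a : R,
  [/\ 0 < alpha, 0 < a, a <= 1 &
    forall K L K' L' c, 0 <= c -> rows_shared K L K' L' M i ->
    (forall z, triangle R z -> row_integrable K L i z) ->
    (forall z, triangle R z -> row_integrable K' L' i z) ->
    row_close alpha a c (fun z => K z i) (fun z => K' z i)
      (fun z => L z i) (fun z => L' z i) ->
    row_close alpha a (c / 2)
      (fun z j => updateK K L i j z) (fun z j => updateK K' L' i j z)
      (fun z j => updateL K L i j z) (fun z j => updateL K' L' i j z)].
Proof.
move=> M0.
have [C1 C10 hC1] := finite_ub (reaction_lipschitz Spp Smp M i).
have [C2 C20 hC2] := finite_ub (reaction_lipschitz Smm Spm M i).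
have [q q0 hq] := finite_ub (fun j : 'I_m => (mu j)^-1 * \sum_(k < n) `|lambda k * Q0 k j|).
pose C := C1 + C2 + 1; have C0 : 0 < C by rewrite ltr_wpDl// addr_ge0.
(* With [q * a <= 1/4], the boundary values of [K] contribute at most a quarter of the weight of
   [L]. *)
pose a := (4 * (q + 1))^-1.
have q1 : 0 < q + 1 by rewrite ltr_wpDl.
have a0 : 0 < a by rewrite invr_gt0 mulr_gt0.
have qa : q * a <= 4^-1.
  by rewrite /a invfM mulrCA ler_piMr// ler_pdivrMr// mul1r lerDl.
have a1 : a <= 1 by rewrite /a invf_le1 ?mulr_gt0//; lra.
have mi := mu_gt0 i.
(* Chosen after [a], so that the integral terms gain the factor [a / 4]: a quarter of the weight of
   [K], and at most a quarter of that of [L]. *)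
pose alpha := 4 * C / (a * mu i).
have al0 : 0 < alpha by rewrite divr_gt0 ?mulr_gt0.
have Ca : C / (alpha * mu i) = a / 4.
  by rewrite /alpha; field; rewrite !gt_eqF.
exists alpha, a; split => // K L K' L' c c0 sh KLi KLi' cl.
(* [omega] reads [L] on the diagonal, at a point with the same abscissa as [z]. The weight depends
   on the abscissa only, so nothing is lost. *)
have om z : triangle R z -> forall p,
    `|omega mu Smm L i p z.1 - omega mu Smm L' i p z.1|
      <= `|mu i - mu p| * (c * expR (alpha * z.1)).
  move=> [z0 z1 z2] p; rewrite /omega opprD addrACA subrr addr0 -mulrBr normrM.
  rewrite ler_wpM2l//; have Tz : triangle R (z.1, z.1) by [].
  by have [_] := cl _ Tz; exact.
have omi z L0 : omega mu Smm L0 i i z = Smm i i by rewrite /omega subrr mul0r add0r.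
have clK z : triangle R z -> forall j,
    `|K z i j - K' z i j| <= c * expR (alpha * z.1).
  move=> Tz j; have [h _] := cl _ Tz; apply: le_trans (h j) _.
  by rewrite ler_wpM2l// ler_piMl// expR_ge0.
have clL z : triangle R z -> forall j,
    `|L z i j - L' z i j| <= c * expR (alpha * z.1).
  by move=> Tz; have [_] := cl _ Tz.
have ce z : 0 <= c * expR (alpha * z) by rewrite mulr_ge0// expR_ge0.
have dK z j : triangle R z -> `|rhsK K L i j z - rhsK K' L' i j z|
    <= C * c * expR (alpha * z.1).
  move=> Tz; rewrite !rhsK_reaction -mulrA.
  apply: le_trans (@reaction_dist _ _ _ _ _ _ _ _ _ _ M _ i j _ (ce z.1) _ _ _ _ _ _) _ => //.
  - by move=> p k ip; have [h _] := sh z p Tz ip.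
  - exact: clK.
  - exact: clL.
  - exact: om.
  - by rewrite ler_wpM2r// (le_trans (hC1 j))// /C; lra.
have dL z j : triangle R z -> `|rhsL K L i j z - rhsL K' L' i j z|
    <= C * c * expR (alpha * z.1).
  move=> Tz; rewrite !rhsL_reaction -mulrA.
  apply: le_trans (@reaction_dist _ _ _ _ _ _ _ _ _ _ M _ i j _ (ce z.1) _ _ _ _ _ _) _ => //.
  - by move=> p k ip; have [_ h] := sh z p Tz ip.
  - exact: clL.
  - exact: clK.
  - exact: om.
  - by rewrite ler_wpM2r// (le_trans (hC2 j))// /C; lra.
have Cc0 : 0 <= C * c by rewrite mulr_ge0// ltW.
have Cca : C * c / (alpha * mu i) = c * a / 4.
  by rewrite -mulrA mulrCA -[_ * a / 4]mulrA -Ca.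
move=> z Tz; have [iK iL] := KLi z Tz; have [iK' iL'] := KLi' z Tz.
have e0 := expR_ge0 (alpha * z.1).
split=> j.
  rewrite /updateK opprD addrACA subrr add0r.
  apply: le_trans (Rintegral_exp_decay Cc0 al0 mi (iK j) (iK' j) (x := z.1) _) _.
    by move=> s st; apply: le_trans (dK _ j _) _ => //; exact: lineK_triangle.
  rewrite Cca mulrA ler_wpM2r//.
  by have : 0 <= c * a by [rewrite mulr_ge0// ltW]; lra.
rewrite /updateL opprD addrACA (le_trans (ler_normD _ _))//.
(* One quarter pays for the boundary term, the other for the integral. *)
have -> : c / 2 * expR (alpha * z.1) =
  c / 4 * expR (alpha * z.1) + c / 4 * expR (alpha * z.1) by field.
apply: lerD; last first.
  apply: le_trans (Rintegral_exp_decay Cc0 al0 mi (iL j) (iL' j) (x := z.1) _) _.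
    by move=> s st; apply: le_trans (dL _ j _) _ => //; exact: lineL_triangle.
  rewrite Cca ler_wpM2r// ler_wpM2r//.
  by rewrite ler_piMr.
rewrite /terminalL; case: ifPn => [_|nd].
  by rewrite subrr normr0 mulr_ge0// divr_ge0.
rewrite -mulrBr -sumrB normrM (ger0_norm (_ : 0 <= (mu j)^-1)); last first.
  by rewrite invr_ge0 ltW.
have Tt := terminal_point_triangle Tz nd.
have t0 := timeL_ge0 i j Tz.
set B := a * (c * expR (alpha * z.1)).
(* The characteristic runs towards smaller abscissas, so the exponential at its end is at most the
   one at [z]; the factor [a] is the weight of [K]. *)
have hB k : `|K ((lineL i j z (timeL i j z)).1, 0) i k -
     K' ((lineL i j z (timeL i j z)).1, 0) i k| <= B.
  have [h _] := cl _ Tt; apply: le_trans (h k) _.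
  rewrite mulrCA /B ler_wpM2l ?(ltW a0)// ler_wpM2l// ler_expR/= ler_wpM2l ?(ltW al0)//.
  by rewrite lerBlDr lerDl mulr_ge0// ltW.
apply: (@le_trans _ _ ((mu j)^-1 * (\sum_(k < n) `|lambda k * Q0 k j|) * B)).
  rewrite -mulrA ler_wpM2l ?invr_ge0 ?(ltW (mu_gt0 j))//.
  rewrite (le_trans (ler_norm_sum _ _ _))// mulr_suml; apply: ler_sum => k _.
  by rewrite -mulrBr normrM ler_wpM2l.
have B0 : 0 <= B by rewrite mulr_ge0// ltW.
apply: (@le_trans _ _ (q * B)); first by rewrite ler_wpM2r.
rewrite /B mulrA [c / 4]mulrC -[leRHS]mulrA ler_wpM2r//.
Qed.

(** * Updates of bounded measurable kernels *)

Definition good_kernel a b (F : R * R -> 'M[R]_(a, b)) :=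
  forall i j, bounded_measurable (fun z => F z i j).

Lemma good_kernel_ub a b (F : R * R -> 'M[R]_(a, b)) : good_kernel F ->
  exists2 M, 0 <= M & forall z i j, `|F z i j| <= M.
Proof.
move=> gF; have /choice[B FB] : forall ij : 'I_a * 'I_b, exists B,
    forall z, `|F z ij.1 ij.2| <= B.
  by move=> [i j]; have [] := gF i j.
have [M M0 BM] := finite_ub B; exists M => // z i j.
exact: le_trans (FB (i, j) z) (BM _).
Qed.

Lemma bounded_measurable_reaction a b (A : 'M[R]_a) (B : 'M[R]_(b, a))
    (X : R * R -> 'M[R]_(m, a)) (Y : R * R -> 'M[R]_(m, b))
    (w : 'I_m -> R * R -> R) i j :
  good_kernel X -> good_kernel Y -> (forall p, bounded_measurable (w p)) ->
  bounded_measurable (fun z => reaction A B (X z) (Y z) (w ^~ z) i j).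
Proof.
move=> gX gY bw; rewrite /reaction.
apply: bounded_measurableB; first apply: bounded_measurableD.
- apply: bounded_measurable_sum => k; apply: bounded_measurableM => //.
  exact: bounded_measurable_cst.
- apply: bounded_measurable_sum => k; apply: bounded_measurableM => //.
  exact: bounded_measurable_cst.
- by apply: bounded_measurable_sum => k; exact: bounded_measurableM.
Qed.

Lemma bounded_measurable_omega L i p : good_kernel L ->
  bounded_measurable (fun z : R * R => omega mu Smm L i p z.1).
Proof.
move=> gL; rewrite /omega; apply: bounded_measurableD.
  apply: bounded_measurableM; first exact: bounded_measurable_cst.
  apply: (bounded_measurable_comp (gL i p)).
  exact: measurable_fun_pair.
exact: bounded_measurable_cst.
Qed.

Lemma bounded_measurable_rhsK K L i j : good_kernel K -> good_kernel L ->
  bounded_measurable (rhsK K L i j).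
Proof.
move=> gK gL; apply: bounded_measurable_reaction => // p.
exact: bounded_measurable_omega.
Qed.

Lemma bounded_measurable_rhsL K L i j : good_kernel K -> good_kernel L ->
  bounded_measurable (rhsL K L i j).
Proof.
move=> gK gL; apply: bounded_measurable_reaction => // p.
exact: bounded_measurable_omega.
Qed.

Lemma measurable_line (u v : R) :
  measurable_fun setT (fun p : (R * R) * R => (p.1.1 - u * p.2, p.1.2 + v * p.2)).
Proof.
apply: measurable_fun_pair => /=.
  apply: measurable_funB; first exact: measurableT_comp.
  by apply: measurable_funM.
apply: measurable_funD; first exact: measurableT_comp.
by apply: measurable_funM.
Qed.

Lemma measurable_lineK i j :
  measurable_fun setT (fun p : (R * R) * R => lineK i j p.1 p.2).
Proof. exact: measurable_line. Qed.

Lemma measurable_lineL i j :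
  measurable_fun setT (fun p : (R * R) * R => lineL i j p.1 p.2).
Proof.
have := measurable_line (mu i) (- mu j).
by apply: eq_measurable_fun => p _; rewrite /lineL mulNr.
Qed.

Lemma row_integrable_good K L i z : good_kernel K -> good_kernel L ->
  row_integrable K L i z.
Proof.
move=> gK gL; split=> j; apply: bounded_measurable_integrable.
- apply: (bounded_measurable_comp (bounded_measurable_rhsK i j gK gL)).
  exact: (measurableT_comp (measurable_lineK i j) (pair1_measurable z)).
- apply: (bounded_measurable_comp (bounded_measurable_rhsL i j gK gL)).
  exact: (measurableT_comp (measurable_lineL i j) (pair1_measurable z)).
Qed.

Lemma measurable_timeK i j : measurable_fun setT (timeK i j).
Proof. by apply: measurable_funM => //; exact: measurable_funB. Qed.

Lemma measurable_ends_on_diagonal i j :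
  measurable_fun setT (ends_on_diagonal mu i j).
Proof.
apply: measurable_and => //; apply: measurable_fun_ler => //.
by apply: measurable_funB; apply: measurable_funM.
Qed.

Lemma measurable_timeL i j : measurable_fun setT (timeL i j).
Proof.
apply: measurable_fun_ifT; first exact: measurable_ends_on_diagonal.
  by apply: measurable_funM => //; exact: measurable_funB.
exact: measurable_funM.
Qed.

Lemma measurable_updateK K L i j : good_kernel K -> good_kernel L ->
  measurable_fun setT (updateK K L i j).
Proof.
move=> gK gL; apply: measurable_funD => //.
apply: (measurable_fun_Rintegral_itv (measurable_timeK i j)
  (f := fun p => rhsK K L i j (lineK i j p.1 p.2))).
have [mr _] := bounded_measurable_rhsK i j gK gL.
exact: (measurableT_comp mr (measurable_lineK i j)).
Qed.

Lemma measurable_updateL K L i j : good_kernel K -> good_kernel L ->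
  measurable_fun setT (updateL K L i j).
Proof.
move=> gK gL; apply: measurable_funD.
  apply: measurable_fun_ifT => //; first exact: measurable_ends_on_diagonal.
  apply: measurable_funM => //; apply: measurable_sum => k.
  apply: measurable_funM => //; have [mK _] := gK i k.
  apply: (measurableT_comp mK); apply: measurable_fun_pair => //.
  apply: measurable_funB => //; apply: measurable_funM => //.
  exact: measurable_timeL.
apply: (measurable_fun_Rintegral_itv (measurable_timeL i j)
  (f := fun p => rhsL K L i j (lineL i j p.1 p.2))).
have [mr _] := bounded_measurable_rhsL i j gK gL.
exact: (measurableT_comp mr (measurable_lineL i j)).
Qed.

(** The decay estimate at rate [alpha = 1], compared with the zero function: as long as the abscissa
    stays nonnegative the exponential is at least 1, so a constant bound on [f] suffices. The result
    is uniform in [t]. *)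
Lemma Rintegral_line_ub (f : R -> R) (i : 'I_m) (B x t : R) :
  0 <= B -> x <= 1 -> (forall s, `|f s| <= B) -> (forall s, 0 <= s <= t -> 0 <= x - mu i * s) ->
  (@lebesgue_measure R).-integrable `[0, t] (EFin \o f) ->
  `|\int[@lebesgue_measure R]_(s in `[0, t]) f s| <= B / mu i * expR 1.
Proof.
move=> B0 x1 fB xt fi.
have i0 : (@lebesgue_measure R).-integrable `[0, t] (EFin \o (fun=> 0 : R)).
  by apply: bounded_measurable_integrable; exact: bounded_measurable_cst.
have := @Rintegral_exp_decay R f (fun=> 0) B 1 (mu i) x t B0 ltr01 (mu_gt0 i) fi i0.
have mt : measurable (`[0, t] : set (measurableTypeR R)) by exact: measurable_itv.
rewrite [X in _ - X](_ : _ = 0) ?subr0; last by rewrite Rintegral_cst// mul0r.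
rewrite !mul1r => h; apply: le_trans (h _) _.
  move=> s st; rewrite subr0 mul1r (le_trans (fB s))// ler_peMr//.
  by rewrite -expR0 ler_expR xt.
by rewrite ler_wpM2l ?ler_expR// divr_ge0// ltW.
Qed.

Lemma updateK_bounded K L i j : good_kernel K -> good_kernel L ->
  exists B, forall z, triangle R z -> `|updateK K L i j z| <= B.
Proof.
move=> gK gL; have [_ [B rB]] := bounded_measurable_rhsK i j gK gL.
have B0 : 0 <= B by exact: le_trans (rB (0, 0)).
exists (`|terminalK i j| + B / mu i * expR 1) => z Tz.
rewrite (le_trans (ler_normD _ _))// lerD//.
have [iK _] := row_integrable_good i z gK gL.
case: (Tz) => /andP[_ z1] _ _; apply: (Rintegral_line_ub (x := z.1)) => // s st.
by have [/andP[]] := lineK_triangle Tz st.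
Qed.

Lemma updateL_bounded K L i j : good_kernel K -> good_kernel L ->
  exists B, forall z, triangle R z -> `|updateL K L i j z| <= B.
Proof.
move=> gK gL; have [_ [B rB]] := bounded_measurable_rhsL i j gK gL.
have B0 : 0 <= B by exact: le_trans (rB (0, 0)).
have [M M0 KM] := good_kernel_ub gK.
exists (`|Smm i j / (mu i - mu j)| + `|(mu j)^-1| * \sum_(k < n) (`|lambda k * Q0 k j| * M)
  + B / mu i * expR 1) => z Tz.
have S0 : 0 <= `|(mu j)^-1| * \sum_(k < n) (`|lambda k * Q0 k j| * M).
  by rewrite mulr_ge0// sumr_ge0// => k _; rewrite mulr_ge0.
rewrite (le_trans (ler_normD _ _))// lerD//.
  rewrite /terminalL; case: ifP => _; first by rewrite normrN lerDl.
  rewrite normrM (@le_trans _ _ (`|(mu j)^-1| * \sum_(k < n) (`|lambda k * Q0 k j| * M)))//.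
    rewrite ler_wpM2l// (le_trans (ler_norm_sum _ _ _))//; apply: ler_sum => k _.
    by rewrite normrM ler_wpM2l.
  by rewrite lerDr.
have [_ iL] := row_integrable_good i z gK gL.
case: (Tz) => /andP[_ z1] _ _; apply: (Rintegral_line_ub (x := z.1)) => // s st.
by have [/andP[]] := lineL_triangle Tz st.
Qed.

Lemma measurable_in_triangle : measurable_fun setT (fun z : R * R => z \in triangle R).
Proof.
rewrite (_ : (fun z => _) = fun z : R * R =>
    (0 <= z.1) && (z.1 <= 1) && ((0 <= z.2) && (z.2 <= 1)) && (z.2 <= z.1)).
  by apply: measurable_and; [apply: measurable_and; apply: measurable_and|];
    apply: measurable_fun_ler.
apply/funext => z; apply/idP/idP; first by rewrite inE => -[-> -> ->].
by move=> /andP[/andP[? ?] ?]; rewrite inE.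
Qed.

(** Outside the triangle an update may grow with the length of the characteristic; cutting it off to
    0 restores a global bound. *)
Lemma bounded_measurable_on_triangle (f : R * R -> R) :
  measurable_fun setT f -> (exists B, forall z, triangle R z -> `|f z| <= B) ->
  bounded_measurable (fun z => if z \in triangle R then f z else 0).
Proof.
move=> mf [B fB]; split.
  by apply: measurable_fun_ifT => //; exact: measurable_in_triangle.
exists `|B| => z; case: ifPn => [|_]; last by rewrite normr0.
by rewrite inE => /fB /le_trans; apply; exact: ler_norm.
Qed.

(** * Existence, row by row *)

(** The system is triangular in the row index: the quadratic sums start at [p], and their
    coefficients involve row [p] of [L] alone. A row can thus be replaced without disturbing the
    equations of later rows. *)
Lemma update_local K L K' L' (p : 'I_m) :
  (forall z (q : 'I_m), (p <= q)%N ->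
     (forall j, K z q j = K' z q j) /\ (forall j, L z q j = L' z q j)) ->
  updateK K L p = updateK K' L' p /\ updateL K L p = updateL K' L' p.
Proof.
move=> KL.
have eK z (q : 'I_m) j : (p <= q)%N -> K z q j = K' z q j by move=> /(KL z)[].
have eL z (q : 'I_m) j : (p <= q)%N -> L z q j = L' z q j by move=> /(KL z)[].
have eo (q : 'I_m) x : (p <= q)%N -> omega mu Smm L p q x = omega mu Smm L' p q x.
  by move=> _; rewrite /omega eL.
have eR a b A B (X X' : 'M[R]_(m, a)) (Y Y' : 'M[R]_(m, b)) w w' j :
    (forall (q : 'I_m) k, (p <= q)%N -> X q k = X' q k) ->
    (forall (q : 'I_m) k, (p <= q)%N -> Y q k = Y' q k) ->
    (forall q : 'I_m, (p <= q)%N -> w q = w' q) ->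
    reaction A B X Y w p j = reaction A B X' Y' w' p j.
  move=> eX eY ew; rewrite /reaction; congr (_ + _ - _).
  - by apply: eq_bigr => k _; rewrite eX.
  - by apply: eq_bigr => k _; rewrite eY.
  - by apply: eq_bigr => q pq; rewrite eX// ew.
have erK j z : rhsK K L p j z = rhsK K' L' p j z.
  by rewrite !rhsK_reaction; apply: eR => q *; [exact: eK|exact: eL|exact: eo].
have erL j z : rhsL K L p j z = rhsL K' L' p j z.
  by rewrite !rhsL_reaction; apply: eR => q *; [exact: eL|exact: eK|exact: eo].
split; apply/funext => j; apply/funext => z.
  by rewrite /updateK; congr (_ + _); apply: eq_Rintegral => s _; rewrite erK.
rewrite /updateL; congr (_ + _).
  rewrite /terminalL; case: ifP => // _; congr (_ * _).
  by apply: eq_bigr => k _; rewrite eK.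
by apply: eq_Rintegral => s _; rewrite erL.
Qed.

Definition solves_row K L i : Prop := forall z, triangle R z ->
  (forall j, K z i j = updateK K L i j z) /\ (forall j, L z i j = updateL K L i j z).

Definition with_row a (F : R * R -> 'M[R]_(m, a)) (i : 'I_m) (f : 'I_a -> R * R -> R) z :
    'M[R]_(m, a) :=
  \matrix_(p, j) if p == i then f j z else F z p j.

Lemma with_row_good a (F : R * R -> 'M[R]_(m, a)) i f :
  good_kernel F -> (forall j, bounded_measurable (f j)) -> good_kernel (with_row F i f).
Proof.
move=> gF bf p j; rewrite /with_row; under eq_fun do rewrite mxE.
by case: (p == i).
Qed.

(** Row [i] of both kernels is packed into one real function indexed by a disjoint sum, with the
    weights of [row_close], so that the fixed point lemma applies. *)
Lemma row_solvable K L i : good_kernel K -> good_kernel L ->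
  exists k l, let K' := with_row K i k in let L' := with_row L i l in
    [/\ good_kernel K', good_kernel L' & solves_row K' L' i].
Proof.
move=> gK gL.
have [MK MK0 KM] := good_kernel_ub gK.
have [ML ML0 LM] := good_kernel_ub gL.
have M0 : 0 <= MK + ML by rewrite addr_ge0.
have [alpha [a [al0 a0 a1 contr]]] := row_contraction i M0.
pose k (u : ('I_n + 'I_m) * (R * R) -> R) j z := u (inl j, z).
pose l (u : ('I_n + 'I_m) * (R * R) -> R) j z := u (inr j, z).
pose KK u := with_row K i (k u); pose LL u := with_row L i (l u).
pose wt (c : 'I_n + 'I_m) : R := if c is inl _ then a else 1.
(* The zero weight outside the triangle matches the cut-off in [Phi]. *)
pose w (x : ('I_n + 'I_m) * (R * R)) :=
  if x.2 \in triangle R then wt x.1 * expR (alpha * x.2.1) else 0.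
pose upd u (c : 'I_n + 'I_m) := match c with
  | inl j => updateK (KK u) (LL u) i j | inr j => updateL (KK u) (LL u) i j end.
pose Phi u (x : ('I_n + 'I_m) * (R * R)) :=
  if x.2 \in triangle R then upd u x.1 x.2 else 0.
pose E (u : ('I_n + 'I_m) * (R * R) -> R) :=
  forall c, bounded_measurable (fun z => u (c, z)).
have wt0 c : 0 < wt c by case: c.
have awt c : a <= wt c by case: c.
have w0 x : 0 <= w x by rewrite /w; case: ifP => // _; rewrite mulr_ge0 ?expR_ge0// ltW.
have gKK u : E u -> good_kernel (KK u).
  by move=> Eu; apply: with_row_good => // j; exact: Eu.
have gLL u : E u -> good_kernel (LL u).
  by move=> Eu; apply: with_row_good => // j; exact: Eu.
have EPhi u : E u -> E (Phi u).
  move=> Eu c; rewrite /Phi/=; apply: bounded_measurable_on_triangle.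
    by case: c => j; [apply: measurable_updateK|apply: measurable_updateL]; auto.
  by case: c => j; [apply: updateK_bounded|apply: updateL_bounded]; auto.
have E0 : E (fun=> 0) by move=> c; exact: bounded_measurable_cst.
have /choice[B0 PB0] : forall c, exists B, forall z, `|Phi (fun=> 0) (c, z)| <= B.
  by move=> c; have [] := EPhi _ E0 c.
have [B B_ge0 B0B] := finite_ub B0.
(* On the triangle the weight is at least [a], so [2 * B / a] makes half of the weighted bound
   dominate the first iterate, which is at most [B]. *)
have Ba0 : 0 <= 2 * B / a by rewrite divr_ge0 ?mulr_ge0// ltW.
have [|||u Eu fu] := @weighted_fixed_point R _ E w Phi (2 * B / a) w0 Ba0 E0 EPhi.
(* Measurability passes to pointwise limits; the bound comes from the weight, which is at most
   [expR alpha] because abscissas are at most 1. *)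
- move=> u v Eu uv vw c; split.
    apply: (measurable_fun_cvg (h := fun p z => u p (c, z))) => [p|z _]; last exact: uv.
    by have [] := Eu p c.
  exists (2 * B / a * expR alpha) => z; apply: le_trans (vw _) _.
  rewrite ler_wpM2l// /w/=; case: ifPn => [|_]; last exact: expR_ge0.
  rewrite inE => -[/andP[_ z1] _ _].
  rewrite -[leRHS]mul1r ler_pM ?expR_ge0 ?(ltW (wt0 c))//; first by case: c.
  by rewrite ler_expR -[leRHS]mulr1 ler_wpM2l// ltW.
- move=> u v c Eu Ev c0 uv x.
  rewrite /Phi /w; case: ifPn => [|_]; last by rewrite subr0 normr0 mulr0.
  case: x => x z /=; rewrite inE => Tz.
  have [||||hK hL] := contr (KK u) (LL u) (KK v) (LL v) c c0 _ _ _ _ z Tz.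
  + move=> y p Ty ip; rewrite /KK /LL /with_row.
    have pi : (p == i) = false by apply/negbTE; rewrite -val_eqE gtn_eqF.
    split=> j; rewrite !mxE pi; split => //.
      by rewrite (le_trans (KM _ _ _))// lerDl.
    by rewrite (le_trans (LM _ _ _))// lerDr.
  + by move=> y _; apply: row_integrable_good; auto.
  + by move=> y _; apply: row_integrable_good; auto.
  + move=> y Ty; have iy : y \in triangle R by rewrite inE.
    rewrite /KK /LL /with_row; split=> j; rewrite !mxE eqxx.
      by have := uv (inl j, y); rewrite /w/= iy.
    by have := uv (inr j, y); rewrite /w/= iy mul1r.
  + by case: x => j; [exact: hK|rewrite mul1r; exact: hL].
- case=> c z; rewrite /w/=; case: ifPn => [|/negbTE Tz]; last first.
    by rewrite /Phi/= Tz normr0 mulr0.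
  rewrite inE => -[/andP[z0 _] _ _].
  apply: le_trans (PB0 c z) _; apply: le_trans (B0B c) _.
  have -> : 2 * B / a / 2 = B / a by field; rewrite gt_eqF.
  rewrite -mulrA ler_peMr// mulrA mulr_ege1//.
    by rewrite mulrC ler_pdivlMr// mul1r.
  by rewrite -expR0 ler_expR mulr_ge0// ltW.
exists (k u), (l u); split; [exact: gKK|exact: gLL|].
move=> z Tz; have iz : z \in triangle R by rewrite inE.
split=> j; rewrite {1}/with_row mxE eqxx.
  by have := fu (inl j, z); rewrite /Phi/= iz => /esym.
by have := fu (inr j, z); rewrite /Phi/= iz => /esym.
Qed.

Lemma solution_exists :
  exists K L, [/\ good_kernel K, good_kernel L & forall i, solves_row K L i].
Proof.
(* Here [d] counts the rows already solved, starting from the last; for [d = 0] any good kernels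
   will do. *)
suff H d : (d <= m)%N -> exists K L, [/\ good_kernel K, good_kernel L &
    forall i : 'I_m, (m - d <= i)%N -> solves_row K L i].
  have [K [L [gK gL s]]] := H m (leqnn m); exists K, L; split => // i.
  by apply: s; rewrite subnn.
elim: d => [_|d IH dm].
  exists (fun=> 0), (fun=> 0); split=> [i j|i j|i].
  - by under eq_fun do rewrite mxE; exact: bounded_measurable_cst.
  - by under eq_fun do rewrite mxE; exact: bounded_measurable_cst.
  - by rewrite subn0 leqNgt ltn_ord.
have [K [L [gK gL s]]] := IH (ltnW dm).
have im : (m - d.+1 < m)%N by rewrite ltn_subrL (leq_ltn_trans _ dm).
pose i := Ordinal im.
have [k [l [gK' gL' s']]] := row_solvable i gK gL.
exists (with_row K i k), (with_row L i l); split => // p.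
rewrite leq_eqVlt => /orP[/eqP ip|ip].
  by have <- : i = p by exact/val_inj.
have sp : solves_row K L p by apply: s; rewrite -subSS subSn.
have other (q : 'I_m) : (p <= q)%N -> (q == i) = false.
  by move=> pq; apply/negbTE; rewrite -val_eqE/= gtn_eqF// (leq_trans ip).
move=> z Tz; have [sK sL] := sp z Tz.
(* For [p > i] the update reads rows from [p] on, none of which is row [i], so the rows solved
   earlier stay solved. *)
have [eK eL] : updateK (with_row K i k) (with_row L i l) p = updateK K L p /\
    updateL (with_row K i k) (with_row L i l) p = updateL K L p.
  by apply: update_local => y q pq; split=> j; rewrite mxE other.
by rewrite eK eL; split=> j; rewrite mxE other.
Qed.

(** * Uniqueness among bounded solutions *)

(** Going up from the last row, the later rows already coincide, so [row_contraction] applies to row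
    [i] with the two solutions as fixed points. *)
Lemma solves_row_unique K L K' L' :
  bounded_kernel K -> bounded_kernel L -> bounded_kernel K' -> bounded_kernel L' ->
  (forall i z, triangle R z -> row_integrable K L i z) ->
  (forall i z, triangle R z -> row_integrable K' L' i z) ->
  (forall i, solves_row K L i) -> (forall i, solves_row K' L' i) ->
  forall i z, triangle R z -> (forall j, K z i j = K' z i j) /\ (forall j, L z i j = L' z i j).
Proof.
move=> [MK KM] [ML LM] [MK' KM'] [ML' LM'] iKL iKL' sKL sKL'.
suff H d (i : 'I_m) : (m - i <= d)%N -> forall z, triangle R z ->
    (forall j, K z i j = K' z i j) /\ (forall j, L z i j = L' z i j).
  by move=> i; exact: (H (m - i)%N).
elim: d i => [i|d IH i mid]; first by rewrite leqn0 subn_eq0 leqNgt ltn_ord.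
have sub (p : 'I_m) : (i < p)%N -> forall z, triangle R z ->
    (forall j, K z p j = K' z p j) /\ (forall j, L z p j = L' z p j).
  move=> ip; apply: IH; rewrite -ltnS (leq_trans _ mid)//.
  by rewrite ltn_sub2l.
(* The bounds supplied by [bounded_kernel] carry no sign, hence the absolute values. *)
have M0 : 0 <= `|MK| + `|ML| by rewrite addr_ge0.
have [alpha [a [al0 a0 a1 contr]]] := row_contraction i M0.
have sh : rows_shared K L K' L' (`|MK| + `|ML|) i.
  move=> z p Tz ip; have [eK eL] := sub p ip z Tz; split=> j; split => //.
    by rewrite (le_trans (KM _ _ _ Tz))// (le_trans (ler_norm _))// lerDl.
  by rewrite (le_trans (LM _ _ _ Tz))// (le_trans (ler_norm _))// lerDr.
pose B := `|MK| + `|MK'| + `|ML| + `|ML'|.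
have B0 : 0 <= B by rewrite !addr_ge0.
(* The factor [B / a] starts the induction: abscissas are nonnegative, so the weights of [K] and [L]
   are at least [a] and 1. Each further update halves the bound and leaves both solutions fixed. *)
have close p : row_close alpha a (B / a / 2 ^+ p) (fun z => K z i) (fun z => K' z i)
    (fun z => L z i) (fun z => L' z i).
  elim: p => [|p IHp].
    rewrite expr0 divr1 => z Tz.
    have e1 : 1 <= expR (alpha * z.1).
      by case: Tz => /andP[z0 _] _ _; rewrite -expR0 ler_expR mulr_ge0// ltW.
    have Ba : B <= B / a by rewrite ler_pdivlMr// ler_piMr.
    split=> j.
      rewrite mulrA divfK ?gt_eqF// -[leLHS]mulr1 ler_pM// (le_trans (ler_normB _ _))//.
      have := le_trans (KM z i j Tz) (ler_norm MK).
      have := le_trans (KM' z i j Tz) (ler_norm MK').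
      rewrite /B; have := normr_ge0 ML; have := normr_ge0 ML'; lra.
    rewrite -[leLHS]mulr1 ler_pM// (le_trans _ Ba)// (le_trans (ler_normB _ _))//.
    have := le_trans (LM z i j Tz) (ler_norm ML).
    have := le_trans (LM' z i j Tz) (ler_norm ML').
    rewrite /B; have := normr_ge0 MK; have := normr_ge0 MK'; lra.
  have c0 : 0 <= B / a / 2 ^+ p by rewrite !divr_ge0 ?exprn_ge0// ltW.
  have cl := contr K L K' L' _ c0 sh (iKL i) (iKL' i) IHp.
  rewrite exprSr invfM mulrA => z Tz.
  have [sK sL] := sKL i z Tz; have [sK' sL'] := sKL' i z Tz.
  have [hK hL] := cl z Tz.
  by split=> j; rewrite ?sK ?sK' ?sL ?sL'; [exact: hK|exact: hL].
move=> z Tz; split=> j; apply/eqP; rewrite -subr_eq0; apply/eqP.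
  apply: (@eq0_of_halving _ _ (B / a * (a * expR (alpha * z.1)))) => p.
  by rewrite mulrAC; have [h _] := close p z Tz; exact: h.
apply: (@eq0_of_halving _ _ (B / a * expR (alpha * z.1))) => p.
by rewrite mulrAC; have [_ h] := close p z Tz; exact: h.
Qed.

End Rows.

Theorem theorem1 (R : realType) (m n : nat)
    (mu : 'I_m -> R) (lambda : 'I_n -> R)
    (Spp : 'M[R]_n) (Spm : 'M[R]_(n, m))
    (Smp : 'M[R]_(m, n)) (Smm : 'M[R]_m) (Q0 : 'M[R]_(n, m))
    (m_ge1 : (1 <= m)%N) (n_ge1 : (1 <= n)%N)
    (mu_gt0 : forall i, 0 < mu i)
    (mu_incr : forall i j : 'I_m, (i < j)%N -> mu i < mu j)
    (lambda_gt0 : forall j, 0 < lambda j)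
    (lambda_nondecr : forall j k : 'I_n, (j <= k)%N -> lambda j <= lambda k) :
  exists (K : R * R -> 'M[R]_(m, n)) (L : R * R -> 'M[R]_m),
    [/\ Linfty_kernel K,
        Linfty_kernel L,
        is_solution mu lambda Spp Spm Smp Smm Q0 K L
      & forall (K' : R * R -> 'M[R]_(m, n)) (L' : R * R -> 'M[R]_m),
          is_solution mu lambda Spp Spm Smp Smm Q0 K' L' ->
          agree_on_triangle K' K /\ agree_on_triangle L' L].
Proof.
have [K [L [gK gL sKL]]] :=
  solution_exists Spp Spm Smp Smm Q0 mu_gt0 mu_incr lambda_gt0.
have bK : bounded_kernel K.
  by have [M _ KM] := good_kernel_ub gK; exists M => z i j _.
have bL : bounded_kernel L.
  by have [M _ LM] := good_kernel_ub gL; exists M => z i j _.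
have iKL i z := row_integrable_good mu lambda Spp Spm Smp Smm i z gK gL.
exists K, L; split.
- by split => // i j; have [mK _] := gK i j; exact: measurable_funTS.
- by split => // i j; have [mL _] := gL i j; exact: measurable_funTS.
- split=> // z i j Tz; have [iK iL] := iKL i z; have [sK sL] := sKL i z Tz.
    by split; [exact: iK|exact: sK].
  by split; [exact: iL|exact: sL].
move=> K' L' [bK' bL' eK eL].
(* The competitor is not assumed measurable; the integrability of its right-hand sides is read off
   [eq_plus_integral]. *)
have u := solves_row_unique mu_gt0 mu_incr lambda_gt0 bK' bL' bK bL _
  (fun i z _ => iKL i z) _ sKL.
have {}u i z (Tz : triangle R z) :
    (forall j, K' z i j = K z i j) /\ (forall j, L' z i j = L z i j).
  apply: u => // {}i {}z {}Tz.
    by split=> j; [have [] := eK z i j Tz|have [] := eL z i j Tz].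
  by split=> j; [have [] := eK z i j Tz|have [] := eL z i j Tz].
by split=> z Tz; apply/matrixP => i j; have [] := u i z Tz.
Qed.
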